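(* Let $(A,m,u,\Delta,\varepsilon,\Phi,s,\alpha,\beta)$ be a quasi-Hopf algebra over a field $\Bbbk$. The map $S\colon A\to A$ defined by $S(a)=\beta s(a)\alpha$ for all $a\in A$ is a preantipode for $A$.
   Context: $\Bbbk$ is a field, $\otimes=\otimes_\Bbbk$; Sweedler notation $\Delta(a)=a_1\otimes a_2$ (summation understood). Quasi-bialgebra: $(A,m,u)$ is an associative unital $\Bbbk$-algebra, $\Delta\colon A\to A\otimes A$ and $\varepsilon\colon A\to\Bbbk$ are algebra maps, $\Phi=\Phi^1\otimes\Phi^2\otimes\Phi^3\in A\otimes A\otimes A$ is invertible with inverse $\Phi^{-1}=\phi^1\otimes\phi^2\otimes\phi^3$, and, writing $A$ for $\mathrm{Id}_A$: $(A\otimes A\otimes\Delta)(\Phi)\cdot(\Delta\otimes A\otimes A)(\Phi)=(1\otimes\Phi)\cdot(A\otimes\Delta\otimes A)(\Phi)\cdot(\Phi\otimes1)$; $(\varepsilon\otimes A\otimes A)(\Phi)=(A\otimes\varepsilon\otimes A)(\Phi)=(A\otimes A\otimes\varepsilon)(\Phi)=1\otimes1$; $(A\otimes\Delta)(\Delta(a))\cdot\Phi=\Phi\cdot(\Delta\otimes A)(\Delta(a))$; $\varepsilon(a_1)a_2=a=a_1\varepsilon(a_2)$ for all $a\in A$. A quasi-Hopf algebra is a quasi-bialgebra with elements $\alpha,\beta\in A$ and an antimultiplicative ($\Bbbk$-linear, $s(ab)=s(b)s(a)$) endomorphism $s$ of $A$ such that for all $a\in A$: $s(a_1)\alpha a_2=\varepsilon(a)\alpha$,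 $a_1\beta s(a_2)=\varepsilon(a)\beta$, $\Phi^1\beta s(\Phi^2)\alpha\Phi^3=1$, $s(\phi^1)\alpha\phi^2\beta s(\phi^3)=1$. The triple $(s,\alpha,\beta)$ is called a quasi-antipode. A preantipode for $A$ is a $\Bbbk$-linear map $S\colon A\to A$ such that, for all $a,b\in A$, $a_1S(ba_2)=\varepsilon(a)S(b)$, $S(a_1b)a_2=\varepsilon(a)S(b)$, and $\Phi^1S(\Phi^2)\Phi^3=1$. *)

(* Defs.v *)
From HB Require Import structures.
From mathcomp Require Import all_boot all_algebra.
From mathcomp Require Import boolp classical_sets.

Set Implicit Arguments.
Unset Strict Implicit.
Unset Printing Implicit Defensive.
Import GRing.Theory.

Local Open Scope ring_scope.
Local Open Scope quotient_scope.

Reserved Notation "x ⊗ y" (at level 38, left associativity).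
Reserved Notation "\tsum_ ( x , y <- t ) E"
  (at level 41, x binder, y binder, E at level 41,
   format "'[' \tsum_ ( x ,  y  <-  t ) '/  '  E ']'").
Reserved Notation "\tsum_ ( x , y , z <- t ) E"
  (at level 41, x binder, y binder, z binder, E at level 41,
   format "'[' \tsum_ ( x ,  y ,  z  <-  t ) '/  '  E ']'").

(* U ⊗ V is presented by generators and relations: a formal sum of pure
   tensors is a list of pairs, and [tensor_rel] is the least congruence for
   concatenation making it commutative and (u, v) |-> [:: (u, v)] balanced
   bilinear. *)
Section TensorDef.
Variables (K : fieldType) (U V : lmodType K).

Inductive tensor_rel : seq (U * V) -> seq (U * V) -> Prop :=
| tensor_rel_refl s : tensor_rel s s
| tensor_rel_sym s t : tensor_rel s t -> tensor_rel t s
| tensor_rel_trans s t r : tensor_rel s t -> tensor_rel t r -> tensor_rel s r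
| tensor_rel_cat s t s' t' :
    tensor_rel s t -> tensor_rel s' t' -> tensor_rel (s ++ s') (t ++ t')
| tensor_relC s t : tensor_rel (s ++ t) (t ++ s)
| tensor_relDl u u' v : tensor_rel [:: (u + u', v)] [:: (u, v); (u', v)]
| tensor_relDr u v v' : tensor_rel [:: (u, v + v')] [:: (u, v); (u, v')]
| tensor_relZ a u v : tensor_rel [:: (a *: u, v)] [:: (u, a *: v)]
| tensor_rel0 v : tensor_rel [:: (0, v)] [::].

Definition tensor_eq (s t : seq (U * V)) : bool := `[< tensor_rel s t >].

Lemma tensor_eq_equiv : equiv_class_of tensor_eq.
Proof.
split=> [s | s t | s t r].
- exact/asboolP/tensor_rel_refl.
- by apply/asboolP/asboolP; apply: tensor_rel_sym.
- by move=> /asboolP st /asboolP sr; apply/asboolP/(tensor_rel_trans st sr).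
Qed.

Canonical tensor_eq_rel := EquivRelPack tensor_eq_equiv.

Definition tensor := {eq_quot tensor_eq_rel}.
HB.instance Definition _ := Choice.on tensor.

Definition tensor_pi (s : seq (U * V)) : tensor := \pi_({eq_quot tensor_eq_rel}) s.
Definition tensor_repr (t : tensor) : seq (U * V) :=
  repr (t : {eq_quot tensor_eq_rel}).

Lemma tensor_reprK : cancel tensor_repr tensor_pi.
Proof. exact: reprK. Qed.

Lemma tensor_piP s t : tensor_rel s t <-> tensor_pi s = tensor_pi t.
Proof.
split=> [st | /eqmodP /asboolP //].
by apply/eqmodP/asboolP.
Qed.

Lemma tensor_pirP s : tensor_rel (tensor_repr (tensor_pi s)) s.
Proof. by apply/tensor_piP; rewrite tensor_reprK. Qed.

Definition tensor_map (f : U -> U) (s : seq (U * V)) :=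
  [seq (f p.1, p.2) | p <- s].

Lemma tensor_map_rel (f : {linear U -> U}) s t :
  tensor_rel s t -> tensor_rel (tensor_map f s) (tensor_map f t).
Proof.
rewrite /tensor_map; elim=> {s t} /=.
- by move=> s; apply: tensor_rel_refl.
- by move=> s t _; apply: tensor_rel_sym.
- by move=> s t r _ st _; apply: tensor_rel_trans.
- by move=> s t s' t' _ st _ st'; rewrite !map_cat; apply: tensor_rel_cat.
- by move=> s t; rewrite !map_cat; apply: tensor_relC.
- by move=> u u' v; rewrite raddfD; apply: tensor_relDl.
- by move=> u v v'; apply: tensor_relDr.
- by move=> a u v; rewrite linearZ; apply: tensor_relZ.
- by move=> v; rewrite raddf0; apply: tensor_rel0.
Qed.

Definition tensor_zero := tensor_pi [::].
Definition tensor_add x y := tensor_pi (tensor_repr x ++ tensor_repr y).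
Definition tensor_scale a x := tensor_pi (tensor_map ( *:%R a) (tensor_repr x)).
Definition tensor_opp x := tensor_scale (-1) x.

Lemma tensor_addE s t :
  tensor_add (tensor_pi s) (tensor_pi t) = tensor_pi (s ++ t).
Proof. by apply/tensor_piP/tensor_rel_cat; apply: tensor_pirP. Qed.

Lemma tensor_scaleE a s :
  tensor_scale a (tensor_pi s) = tensor_pi (tensor_map ( *:%R a) s).
Proof. by apply/tensor_piP/tensor_map_rel/tensor_pirP. Qed.

Lemma tensor_addA : associative tensor_add.
Proof.
move=> x y z; rewrite -[x]tensor_reprK -[y]tensor_reprK -[z]tensor_reprK.
by rewrite !tensor_addE catA.
Qed.

Lemma tensor_addC : commutative tensor_add.
Proof. by move=> x y; apply/tensor_piP/tensor_relC. Qed.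

Lemma tensor_add0 : left_id tensor_zero tensor_add.
Proof. by move=> x; rewrite -[x in LHS]tensor_reprK tensor_addE tensor_reprK. Qed.

Lemma tensor_scaleDl x a b :
  tensor_scale (a + b) x = tensor_add (tensor_scale a x) (tensor_scale b x).
Proof.
rewrite tensor_addE; apply/tensor_piP; elim: (tensor_repr x) => [|[u v] s IHs] /=.
  exact: tensor_rel_refl.
rewrite scalerDl; apply: (tensor_rel_trans
  (t := ([:: (a *: u, v)] ++ [:: (b *: u, v)]) ++
        (tensor_map ( *:%R a) s ++ tensor_map ( *:%R b) s))).
  by rewrite -[_ :: tensor_map _ _]cat1s; apply: tensor_rel_cat; first exact: tensor_relDl.
rewrite -catA -[in X in tensor_rel _ X]cat1s -[(b *: u, v) :: tensor_map _ _]cat1s.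
apply: tensor_rel_cat; first exact: tensor_rel_refl.
rewrite !catA; apply: tensor_rel_cat; last exact: tensor_rel_refl.
exact: tensor_relC.
Qed.

Lemma tensor_scale1 : left_id 1 tensor_scale.
Proof.
move=> x; rewrite -[RHS]tensor_reprK /tensor_scale /tensor_map; congr tensor_pi.
by rewrite -[RHS]map_id; apply: eq_map => -[u v]; rewrite scale1r.
Qed.

Lemma tensor_scale0 x : tensor_scale 0 x = tensor_zero.
Proof.
apply/tensor_piP; elim: (tensor_repr x) => [|[u v] s IHs] /=.
  exact: tensor_rel_refl.
rewrite scale0r -[_ :: _]cat1s -[[::] in X in tensor_rel _ X]cats0.
by apply: tensor_rel_cat; first exact: tensor_rel0.
Qed.

Lemma tensor_addN : left_inverse tensor_zero tensor_opp tensor_add.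
Proof.
move=> x; rewrite /tensor_opp -[x in tensor_add _ x]tensor_scale1.
by rewrite -tensor_scaleDl addNr tensor_scale0.
Qed.

HB.instance Definition _ := GRing.isZmodule.Build tensor
  tensor_addA tensor_addC tensor_add0 tensor_addN.

Lemma tensor_scaleA a b x :
  tensor_scale a (tensor_scale b x) = tensor_scale (a * b) x.
Proof.
rewrite tensor_scaleE; congr tensor_pi; rewrite /tensor_map -map_comp.
by apply: eq_map => -[u v] /=; rewrite scalerA.
Qed.

Lemma tensor_scaleDr : right_distributive tensor_scale +%R.
Proof.
move=> a x y.
rewrite -[RHS]/(tensor_add (tensor_scale a x) (tensor_scale a y)) tensor_addE.
by rewrite -[x + y]/(tensor_add x y) tensor_scaleE /tensor_map map_cat.
Qed.

HB.instance Definition _ := GRing.Zmodule_isLmodule.Build K tensor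
  tensor_scaleA tensor_scale1 tensor_scaleDr tensor_scaleDl.

Definition tens (u : U) (v : V) : tensor := tensor_pi [:: (u, v)].

(* For a bilinear f, [tlift f] is the linear map U ⊗ V -> W it induces
   ([tlift_tens] and [tlift_linear] below), that is the Sweedler-style sum
   of f over any expression of t as a sum of pure tensors. For a map f
   that is not bilinear the value depends on the chosen representative. *)
Definition tlift (W : nmodType) (f : U -> V -> W) (t : tensor) : W :=
  \sum_(p <- tensor_repr t) f p.1 p.2.

End TensorDef.

Arguments tens {K U V} u v : simpl never.
Arguments tlift {K U V W} f t : simpl never.

Notation "U ⊗ V" := (tensor U V) : type_scope.
Notation "u ⊗ v" := (tens u v) : ring_scope.
Notation "\tsum_ ( x , y <- t ) E" := (tlift (fun x y => E) t) : ring_scope.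
(* The sum over t : (U ⊗ V) ⊗ W; the triple tensor product is bracketed to
   the left throughout. *)
Notation "\tsum_ ( x , y , z <- t ) E" :=
  (tlift (fun xy z => tlift (fun x y => E) xy) t) : ring_scope.

Section TensorTheory.
Variables (K : fieldType) (U V : lmodType K).

Lemma tensP (t : U ⊗ V) : t = \sum_(p <- tensor_repr t) p.1 ⊗ p.2.
Proof.
rewrite -[LHS]tensor_reprK; elim: (tensor_repr t) => [|[u v] s IHs].
  by rewrite big_nil.
by rewrite big_cons -IHs [RHS]tensor_addE.
Qed.

Lemma tens_bilinear :
  bilinear_for *:%R *:%R (@tens K U V : U -> V -> (U ⊗ V)%type).
Proof.
have tZ a (u : U) (v : V) : a *: (u ⊗ v) = (a *: u) ⊗ v by exact: tensor_scaleE.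
split=> [v a u u' | u a v v'] /=.
  by rewrite tZ [RHS]tensor_addE; apply/tensor_piP/tensor_relDl.
transitivity (u ⊗ (a *: v) + u ⊗ v').
  by rewrite [RHS]tensor_addE; apply/tensor_piP/tensor_relDr.
congr (_ + _); rewrite tZ; apply/tensor_piP/tensor_rel_sym/tensor_relZ.
Qed.

Variables (W : lmodType K) (f : U -> V -> W).
Hypothesis f_bilin : bilinear_for *:%R *:%R f.

Let fDl u u' v : f (u + u') v = f u v + f u' v.
Proof. by have := f_bilin.1 v 1 u u'; rewrite /= !scale1r. Qed.
Let fDr u v v' : f u (v + v') = f u v + f u v'.
Proof. by have := f_bilin.2 u 1 v v'; rewrite /= !scale1r. Qed.
Let f0l v : f 0 v = 0.
Proof. by apply: (addIr (f 0 v)); rewrite -fDl !add0r. Qed.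
Let f0r u : f u 0 = 0.
Proof. by apply: (addIr (f u 0)); rewrite -fDr !add0r. Qed.
Let fZl a u v : f (a *: u) v = a *: f u v.
Proof. by have := f_bilin.1 v a u 0; rewrite /= f0l !addr0. Qed.
Let fZr a u v : f u (a *: v) = a *: f u v.
Proof. by have := f_bilin.2 u a v 0; rewrite /= f0r !addr0. Qed.

Lemma tlift_rel s t : tensor_rel s t ->
  \sum_(p <- s) f p.1 p.2 = \sum_(p <- t) f p.1 p.2.
Proof.
elim=> {s t} //.
- by move=> s t r _ -> _ ->.
- by move=> s t s' t' _ st _ st'; rewrite !big_cat /= st st'.
- by move=> s t; rewrite !big_cat /= addrC.
- by move=> u u' v; rewrite !(big_cons, big_nil) /= !addr0.
- by move=> u v v'; rewrite !(big_cons, big_nil) /= !addr0.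
- by move=> a u v; rewrite !(big_cons, big_nil) /= !addr0 fZl fZr.
- by move=> v; rewrite !(big_cons, big_nil) /= addr0.
Qed.

Lemma tlift_pi s : tlift f (tensor_pi s) = \sum_(p <- s) f p.1 p.2.
Proof. exact/tlift_rel/tensor_pirP. Qed.

Lemma tlift_tens u v : tlift f (u ⊗ v) = f u v.
Proof. by rewrite tlift_pi big_cons big_nil addr0. Qed.

Lemma tlift_linear : linear (tlift f).
Proof.
move=> a x y; rewrite -[x]tensor_reprK -[y]tensor_reprK.
have -> : a *: tensor_pi (tensor_repr x) + tensor_pi (tensor_repr y) =
  tensor_pi (tensor_map ( *:%R a) (tensor_repr x) ++ tensor_repr y).
  by rewrite -tensor_addE -tensor_scaleE.
rewrite !tlift_pi big_cat /tensor_map big_map scaler_sumr /=; congr (_ + _).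
by apply: eq_bigr => -[u v] _ /=; rewrite fZl.
Qed.

End TensorTheory.

(* Classical (Zorn), since U is not assumed to be finite dimensional. *)
Lemma exists_scalar_form (K : fieldType) (U : lmodType K) (e : U) :
  e != 0 -> exists2 g : U -> K, scalar g & g e = 1.
Proof.
move=> e0.
pose P (M : set U) := ~ M e /\ forall a u v, M u -> M v -> M (a *: u + v).
have [|M [[Me ML] Mmax]] := @Zorn_bigcup U P.
  move=> F FP Ftot; split; first by move=> [Y /FP[nYe _] /nYe].
  move=> a u v [Y FY Yu] [Z FZ Zv].
  have [YZ|ZY] := Ftot Y Z FY FZ.
    by exists Z => //; apply: (FP Z FZ).2 => //; apply: YZ.
  by exists Y => //; apply: (FP Y FY).2 => //; apply: ZY.
have M0 : M 0.
  apply: contrapT => M0; refine (Mmax [set 0 : U]%classic _ _).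
    split=> [z Mz | E]; last by apply: M0; apply: E.
    by case: M0; have := ML (-1) z z Mz Mz; rewrite scaleN1r addNr.
  split=> [/eqP | a u v -> ->]; first by apply/negP.
  by rewrite /= scaler0 addr0.
have MZ a u : M u -> M (a *: u) by move=> Mu; rewrite -[_ *: _]addr0; apply: ML.
have MD u v : M u -> M v -> M (u + v).
  by move=> Mu Mv; rewrite -[u]scale1r; apply: ML.
have span x : exists c, M (x - c *: e).
  have [Mx|nMx] := pselect (M x); first by exists 0; rewrite scale0r subr0.
  pose N : set U := fun y => exists2 c, M (y - c *: x) & true.
  have [y [[c Myc _] yE]] : exists y, N y /\ y = e.
    apply: contrapT => nN; refine (Mmax N _ _).
      split=> [z Mz | E]; first by exists 0; rewrite // scale0r subr0.
      by apply: nMx; apply: E; exists 1; rewrite // scale1r subrr.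
    split=> [Ne | a u v [c Mu _] [d Mv _]]; first by apply: nN; exists e.
    exists (a * c + d) => //.
    rewrite scalerDl -scalerA opprD addrACA -scalerBr.
    exact: ML.
  rewrite {y}yE in Myc.
  have c0 : c != 0.
    by apply: contra_notN Me => /eqP c0; rewrite c0 scale0r subr0 in Myc.
  exists c^-1; have := MZ (- c^-1) _ Myc.
  by rewrite scalerBr scalerA mulNr mulVf // !scaleNr scale1r opprK addrC.
have Muniq d : M (d *: e) -> d = 0.
  move=> Md; apply: contrapT => /eqP d0; apply: Me.
  by have := MZ d^-1 _ Md; rewrite scalerA mulVf // scale1r.
have [g gP] := choice span.
have gE x c : M (x - c *: e) -> g x = c.
  move=> Mc; apply/eqP; rewrite -subr_eq0; apply/eqP/Muniq.
  have := MD _ _ Mc (MZ (-1) _ (gP x)).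
  by rewrite scaleN1r opprB addrC addrA subrK scalerBl.
exists g; last by apply: gE; rewrite scale1r subrr.
move=> a u v; apply: gE; rewrite scalerDl -scalerA opprD addrACA -scalerBr.
exact: ML.
Qed.

Section TensorAlgebra.
Variables (K : fieldType) (A B : algType K).
Implicit Types (x y z : A ⊗ B).

Definition tensor_one : A ⊗ B := 1 ⊗ 1.
Definition tensor_mul x y : A ⊗ B :=
  \tsum_(a, b <- x) \tsum_(a', b' <- y) (a * a') ⊗ (b * b').

Let mul_inner a b :
  bilinear_for *:%R *:%R (fun (a' : A) (b' : B) => (a * a') ⊗ (b * b')).
Proof.
have [tl tr] := tens_bilinear A B.
split=> [b' c u v | a' c u v] /=; rewrite mulrDr -scalerAr.
  exact: tl.
exact: tr.
Qed.

Let mul_outer y : bilinear_for *:%R *:%R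
  (fun (a : A) (b : B) => \tsum_(a', b' <- y) (a * a') ⊗ (b * b')).
Proof.
have [tl tr] := tens_bilinear A B.
rewrite /tlift; split=> [b c u v | a c u v] /=; rewrite scaler_sumr -big_split.
  by apply: eq_bigr => p _; rewrite mulrDl -scalerAl; apply: tl.
by apply: eq_bigr => p _; rewrite mulrDl -scalerAl; apply: tr.
Qed.

Lemma tensor_mul_linl y : linear (tensor_mul^~ y).
Proof. exact: (tlift_linear (mul_outer y)). Qed.

Lemma tensor_mul_linr x : linear (tensor_mul x).
Proof.
move=> c y y'; rewrite /tensor_mul /tlift scaler_sumr -big_split.
apply: eq_bigr => p _; exact: (tlift_linear (mul_inner p.1 p.2)).
Qed.

Lemma tensor_mulE (a a' : A) (b b' : B) :
  tensor_mul (a ⊗ b) (a' ⊗ b') = (a * a') ⊗ (b * b').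
Proof.
by rewrite /tensor_mul (tlift_tens (mul_outer _)) (tlift_tens (mul_inner _ _)).
Qed.

Lemma tensor_mulDl : left_distributive tensor_mul +%R.
Proof. by move=> x y z; have := tensor_mul_linl z 1 x y; rewrite /= !scale1r. Qed.

Lemma tensor_mulDr : right_distributive tensor_mul +%R.
Proof. by move=> x y z; have := tensor_mul_linr x 1 y z; rewrite /= !scale1r. Qed.

Lemma tensor_ind (P : A ⊗ B -> Prop) :
  P 0 -> (forall x y, P x -> P y -> P (x + y)) -> (forall a b, P (a ⊗ b)) ->
  forall x, P x.
Proof.
by move=> P0 PD Pt x; rewrite [x]tensP; apply: big_ind => // p _; apply: Pt.
Qed.

Lemma tensor_mul0l : left_zero 0 tensor_mul.
Proof. by move=> x; apply: (addIr (tensor_mul 0 x)); rewrite -tensor_mulDl !add0r. Qed.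

Lemma tensor_mul0r : right_zero 0 tensor_mul.
Proof. by move=> x; apply: (addIr (tensor_mul x 0)); rewrite -tensor_mulDr !add0r. Qed.

Lemma tensor_mulA : associative tensor_mul.
Proof.
move=> x y z; elim/tensor_ind: x => [|x x' IH IH'|a b].
- by rewrite !tensor_mul0l.
- by rewrite !tensor_mulDl IH IH'.
elim/tensor_ind: y => [|y y' IH IH'|a' b'].
- by rewrite tensor_mul0l !tensor_mul0r tensor_mul0l.
- by rewrite tensor_mulDl !tensor_mulDr tensor_mulDl IH IH'.
elim/tensor_ind: z => [|z z' IH IH'|a'' b''].
- by rewrite !tensor_mul0r.
- by rewrite !tensor_mulDr IH IH'.
by rewrite !tensor_mulE !mulrA.
Qed.

Lemma tensor_mul1l : left_id tensor_one tensor_mul.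
Proof.
elim/tensor_ind=> [|x y IH IH'|a b]; first exact: tensor_mul0r.
  by rewrite tensor_mulDr IH IH'.
by rewrite tensor_mulE !mul1r.
Qed.

Lemma tensor_mul1r : right_id tensor_one tensor_mul.
Proof.
elim/tensor_ind=> [|x y IH IH'|a b]; first exact: tensor_mul0l.
  by rewrite tensor_mulDl IH IH'.
by rewrite tensor_mulE !mulr1.
Qed.

Lemma tensor_one_neq0 : tensor_one != 0.
Proof.
have [g gL g1] := exists_scalar_form (oner_neq0 A).
have [h hL h1] := exists_scalar_form (oner_neq0 B).
have gh : bilinear_for *:%R *:%R (fun (a : A) (b : B) => g a * h b : K^o).
  split=> [b c u v | a c u v] /=; first by rewrite gL mulrDl -mulrA.
  by rewrite hL mulrDr mulrCA.
apply/eqP => E; have := tlift_tens gh 1 1; rewrite -/tensor_one E g1 h1 mulr1.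
have -> : tlift (fun (a : A) (b : B) => g a * h b : K^o) (0 : A ⊗ B) = 0.
  by have := tlift_linear gh (-1) 0 0; rewrite !scaleN1r !addNr.
by move/esym/eqP; rewrite oner_eq0.
Qed.

HB.instance Definition _ := GRing.Zmodule_isNzRing.Build (A ⊗ B)%type
  tensor_mulA tensor_mul1l tensor_mul1r tensor_mulDl tensor_mulDr
  tensor_one_neq0.

Let tensor_scaleAl c x y : c *: (x * y) = (c *: x) * y.
Proof.
have := tensor_mul_linl y c x 0.
by rewrite /= !addr0 tensor_mul0l addr0.
Qed.

Let tensor_scaleAr c x y : c *: (x * y) = x * (c *: y).
Proof.
have := tensor_mul_linr x c y 0.
by rewrite /= !addr0 tensor_mul0r addr0.
Qed.

HB.instance Definition _ :=
  GRing.Lmodule_isLalgebra.Build K (A ⊗ B)%type tensor_scaleAl.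
HB.instance Definition _ :=
  GRing.Lalgebra_isAlgebra.Build K (A ⊗ B)%type tensor_scaleAr.

End TensorAlgebra.

(* In the axioms below (f ⊗ g)(t) is written in Sweedler notation, that is as
   \tsum_(x, y <- t) f x ⊗ g y, which absorbs the canonical isomorphisms
   rebracketing tensor powers of A and K ⊗ A = A = A ⊗ K. Every summand is
   multilinear in the summation variables. *)
Record quasiBialgebra (K : fieldType) (A : algType K) := QuasiBialgebra {
  qdelta : {lrmorphism A -> (A ⊗ A)%type};
  qeps : {lrmorphism A -> K | *%R};
  qPhi : (A ⊗ A ⊗ A)%type;
  qPhi_inv : (A ⊗ A ⊗ A)%type;
  qPhiV : qPhi * qPhi_inv = 1;
  qPhiVl : qPhi_inv * qPhi = 1;
  qPhi_cocycle :
    (\tsum_(x, y, z <- qPhi) \tsum_(z1, z2 <- qdelta z) x ⊗ y ⊗ z1 ⊗ z2) *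
    (\tsum_(x, y, z <- qPhi) \tsum_(x1, x2 <- qdelta x) x1 ⊗ x2 ⊗ y ⊗ z) =
    (\tsum_(x, y, z <- qPhi) (1 : A) ⊗ x ⊗ y ⊗ z) *
    (\tsum_(x, y, z <- qPhi) \tsum_(y1, y2 <- qdelta y) x ⊗ y1 ⊗ y2 ⊗ z) *
    (qPhi ⊗ (1 : A));
  qPhi_eps1 : \tsum_(x, y, z <- qPhi) qeps x *: (y ⊗ z) = 1 ⊗ 1;
  qPhi_eps2 : \tsum_(x, y, z <- qPhi) qeps y *: (x ⊗ z) = 1 ⊗ 1;
  qPhi_eps3 : \tsum_(x, y, z <- qPhi) qeps z *: (x ⊗ y) = 1 ⊗ 1;
  qdeltaA : forall a : A,
    (\tsum_(x, y <- qdelta a) \tsum_(y1, y2 <- qdelta y) x ⊗ y1 ⊗ y2) * qPhi =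
    qPhi * (\tsum_(x, y <- qdelta a) \tsum_(x1, x2 <- qdelta x) x1 ⊗ x2 ⊗ y);
  qeps_l : forall a : A, \tsum_(a1, a2 <- qdelta a) qeps a1 *: a2 = a;
  qeps_r : forall a : A, \tsum_(a1, a2 <- qdelta a) qeps a2 *: a1 = a
}.

(* A quasi-Hopf algebra is a quasi-bialgebra with a quasi-antipode.
   The antimultiplicative map qantip is not required to preserve 1. *)
Record quasiAntipode (K : fieldType) (A : algType K) (Q : quasiBialgebra A) :=
    QuasiAntipode {
  qantip : {linear A -> A};
  qalpha : A;
  qbeta : A;
  qantipM : forall a b, qantip (a * b) = qantip b * qantip a;
  qantip_alpha : forall a : A,
    \tsum_(a1, a2 <- qdelta Q a) qantip a1 * qalpha * a2 = qeps Q a *: qalpha;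
  qantip_beta : forall a : A,
    \tsum_(a1, a2 <- qdelta Q a) a1 * qbeta * qantip a2 = qeps Q a *: qbeta;
  qantip_Phi :
    \tsum_(x, y, z <- qPhi Q) x * qbeta * qantip y * qalpha * z = 1;
  qantip_Phi_inv :
    \tsum_(x, y, z <- qPhi_inv Q) qantip x * qalpha * y * qbeta * qantip z = 1
}.

Record is_preantipode (K : fieldType) (A : algType K) (Q : quasiBialgebra A)
    (S : A -> A) : Prop := IsPreantipode {
  preantipode_linear : linear S;
  preantipode_r : forall a b : A,
    \tsum_(a1, a2 <- qdelta Q a) a1 * S (b * a2) = qeps Q a *: S b;
  preantipode_l : forall a b : A,
    \tsum_(a1, a2 <- qdelta Q a) S (a1 * b) * a2 = qeps Q a *: S b;
  preantipode_Phi : \tsum_(x, y, z <- qPhi Q) x * S y * z = 1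
}.

(* Main.v *)
Require Import Defs.
From HB Require Import structures.
From mathcomp Require Import all_boot all_algebra.
From mathcomp Require Import boolp classical_sets.

(** Antimultiplicativity of [s] lets the factor [s(b)] leave the Sweedler sums:
    [a_1 S(b a_2) = (a_1 beta s(a_2)) s(b) alpha] and
    [S(a_1 b) a_2 = beta s(b) (s(a_1) alpha a_2)], and the bracketed sums are
    [eps(a) beta] and [eps(a) alpha] by the quasi-antipode axioms. The
    normalisation [Phi^1 S(Phi^2) Phi^3 = 1] is, up to associativity, the axiom
    [Phi^1 beta s(Phi^2) alpha Phi^3 = 1]. As [tlift] is a finite sum over one
    fixed representative of the tensor, left and right multiplications pass
    through it ([tlift_mull], [tlift_mulr]) and the summands can be rewritten
    one by one ([eq_tlift]). *)

Set Implicit Arguments.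
Unset Strict Implicit.
Unset Printing Implicit Defensive.
Import GRing.Theory.

Local Open Scope ring_scope.

Lemma eq_tlift (K : fieldType) (U V : lmodType K) (W : nmodType)
    (f g : U -> V -> W) (t : (U ⊗ V)%type) :
  f =2 g -> tlift f t = tlift g t.
Proof. by move=> fg; apply: eq_bigr => p _; apply: fg. Qed.

Lemma tlift_mull (K : fieldType) (U V : lmodType K) (R : pzRingType)
    (f : U -> V -> R) (c : R) (t : (U ⊗ V)%type) :
  \tsum_(x, y <- t) c * f x y = c * tlift f t.
Proof. by rewrite /tlift mulr_sumr. Qed.

Lemma tlift_mulr (K : fieldType) (U V : lmodType K) (R : pzRingType)
    (f : U -> V -> R) (c : R) (t : (U ⊗ V)%type) :
  \tsum_(x, y <- t) f x y * c = tlift f t * c.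
Proof. by rewrite /tlift mulr_suml. Qed.

Theorem theorem4p3 (K : fieldType) (A : algType K) (Q : quasiBialgebra A)
    (H : quasiAntipode Q) :
  is_preantipode Q (fun a : A => qbeta H * qantip H a * qalpha H).
Proof.
split=> [c x y | a b | a b |].
- by rewrite linearP mulrDr mulrDl -scalerAr -scalerAl.
- rewrite -mulrA scalerAl -(qantip_beta H) -tlift_mulr.
  by apply: eq_tlift => x y; rewrite qantipM !mulrA.
- rewrite scalerAr -(qantip_alpha H) -tlift_mull.
  by apply: eq_tlift => x y; rewrite qantipM !mulrA.
- rewrite -[RHS](qantip_Phi H).
  by apply: eq_tlift => t z; apply: eq_tlift => x y; rewrite !mulrA.
Qed.
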